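(* Let $M$ be a smooth manifold and let $B\in\Gamma(\mathrm T^*M\otimes \mathrm T^*M)$ be a non-degenerate tensor field with skew-symmetric part $\omega$ and symmetric part $S$. Suppose that $\mathrm TM=\mathcal H\oplus\mathcal V$, where $\mathcal H=\operatorname{Ker}S$ and $\mathcal V=\operatorname{Ker}\omega$ are vector subbundles. Then the bivector field $\Lambda=-(\mathsf\Lambda^2\widehat B^{-1})(\omega)$ can be completed to a Jacobi structure if, and only if, there exist a 1-form of type $(1,0)$, $\overline\alpha\in\Gamma(\mathcal H^* )$, and a vector field $R\in\Gamma(\mathcal V)$ such that: (i) $(\mathsf\Lambda^3\,{}^{t}\mathrm{pr}_{\mathcal H})(\mathrm d\omega)=\overline\alpha\wedge(\mathsf\Lambda^2\,{}^{t}\mathrm{pr}_{\mathcal H})(\omega)$; (ii) $\mathrm{curv}_{\mathcal H}(X_{\mathcal H},Y_{\mathcal H})=\omega(X_{\mathcal H},Y_{\mathcal H})R$ for all vector fields $X,Y$ on $M$; (iii) writing $\alpha=\overline\alpha+{}^{t}\widehat B(R)$ and $X_\alpha=({}^{t}\widehat B)^{-1}(\alpha)$, one has $(\mathsf\Lambda^2\,{}^{t}\mathrm{pr}_{\mathcal H})(\mathscr L_{X_\alpha}\omega)=0$ and $[X_\alpha,\mathcal H]\subseteq\mathcal H$. The Jacobi structure is then given by $\Lambda=-(\mathsf\Lambda^2\widehat B^{-1})(\omega)$ and $E=X_\alpha=({}^{t}\widehat B)^{-1}(\overline\alpha)+R$.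
   Context: Manifolds are smooth and paracompact, and all objects are smooth. For a 2-covariant tensor field $T$, $\widehat T(v)=T(v,\cdot)$ and ${}^{t}\widehat T(v)=T(\cdot,v)$ as maps $\mathrm TM\to \mathrm T^*M$; $\operatorname{Ker}T$ means $\operatorname{Ker}\widehat T$. $B$ is non-degenerate if $\widehat B$ is an isomorphism. $\omega(u,v)=\frac12(B(u,v)-B(v,u))$, $S(u,v)=\frac12(B(u,v)+B(v,u))$. Explicitly, $\Lambda(\alpha,\beta)=-\omega(\widehat B^{-1}(\alpha),\widehat B^{-1}(\beta))$. $\mathrm{pr}_{\mathcal H},\mathrm{pr}_{\mathcal V}$ are the projections of $\mathrm TM=\mathcal H\oplus\mathcal V$, $X_{\mathcal H}=\mathrm{pr}_{\mathcal H}X$, and $\big((\mathsf\Lambda^k\,{}^{t}\mathrm{pr}_{\mathcal H})(\gamma)\big)(X_1,\dots,X_k)=\gamma(\mathrm{pr}_{\mathcal H}X_1,\dots,\mathrm{pr}_{\mathcal H}X_k)$. A form of type $(1,0)$, i.e. a section of $\mathcal H^*$, is identified with a 1-form on $M$ vanishing on $\mathcal V$. The curvature of $\mathcal H$ is $\mathrm{curv}_{\mathcal H}(X,Y)=\mathrm{pr}_{\mathcal V}[X_{\mathcal H},Y_{\mathcal H}]$. $[X_\alpha,\mathcal H]\subseteq\mathcal H$ means that $[X_\alpha,X]\in\Gamma(\mathcal H)$ for every $X\in\Gamma(\mathcal H)$. $\mathscr L$ is the Lie derivative. A Jacobi structure is a pair $(\Lambda,E)$ of a bivector field and a vector field with $[\Lambda,\Lambda]=-2E\wedge\Lambda$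 and $[\Lambda,E]=0$; $\Lambda$ can be completed to a Jacobi structure if such an $E$ exists. Here $[\cdot,\cdot]$ is the Schouten–Nijenhuis bracket with the sign convention: it extends the Lie bracket of vector fields, $[X,f]=X(f)$, $[P,Q]=-(-1)^{(p-1)(q-1)}[Q,P]$ and $[P,Q\wedge R]=[P,Q]\wedge R+(-1)^{(p-1)q}Q\wedge[P,R]$ for multivector fields of degrees $p,q,r$; the determinant convention is used for wedge products. *)

(* Defs.v *)
From HB Require Import structures.
From mathcomp Require Import all_boot all_order all_algebra.
From mathcomp Require Import all_classical all_reals all_analysis.
From mathcomp Require Import ring.
Set Implicit Arguments.
Unset Strict Implicit.
Unset Printing Implicit Defensive.
Import Order.TTheory GRing.Theory Num.Theory numFieldNormedType.Exports.
Local Open Scope classical_set_scope.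
Local Open Scope ring_scope.

Section SmoothMaps.
Variables (R : realType) (V : normedModType R).

Fixpoint Ck (W : normedModType R) (k : nat) (U : set V) (f : V -> W) : Prop :=
  (forall x, U x -> {for x, continuous f}) /\
  if k is j.+1 then
    forall v, (forall x, U x -> derivable f x v) /\ Ck j U ('D_v f)
  else True.

Definition smooth_on (W : normedModType R) (U : set V) (f : V -> W) : Prop :=
  forall k, Ck k U f.

Lemma Ck_ext (W : normedModType R) k (U : set V) (f g : V -> W) :
  open U -> (forall x, U x -> f x = g x) -> Ck k U f -> Ck k U g.
Proof.
move=> oU; have nearU (h l : V -> W) x : (forall x, U x -> h x = l x) ->
    U x -> \forall y \near x, h y = l y.
  by move=> hl Ux; apply: filterS (open_nbhs_nbhs (conj oU Ux)).
elim: k f g => [|k IH] f g fg /= [cf Df]; split=> //.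
- move=> x Ux; have := cf x Ux; rewrite /prop_for /continuous_at -fg//.
  move=> cfx; apply: cvg_trans cfx; apply: near_eq_cvg.
  by apply: nearU => // y /fg.
- move=> x Ux; have := cf x Ux; rewrite /prop_for /continuous_at -fg//.
  move=> cfx; apply: cvg_trans cfx; apply: near_eq_cvg.
  by apply: nearU => // y /fg.
- move=> v; have [dv Dv] := Df v; split.
    by move=> x Ux; apply: near_eq_derivable (dv x Ux); exact: nearU.
  by apply: IH Dv => x Ux; apply: near_eq_derive; exact: nearU.
Qed.

Lemma Ck_le (W : normedModType R) k (U : set V) (f : V -> W) :
  Ck k.+1 U f -> Ck k U f.
Proof.
elim: k f => [|k IH] f [cf Df]; first by split.
by split=> // v; have [dv Dv] := Df v; split=> //; exact: IH.
Qed.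

Lemma Ck_cst (W : normedModType R) k (U : set V) (a : W) : Ck k U (cst a).
Proof.
elim: k a => [|k IH] a; split=> //; try by move=> x _; exact: cst_continuous.
move=> v; split=> [x _|]; first exact: derivable_cst.
by rewrite (_ : 'D_v _ = cst 0)//; apply/funext => x; rewrite derive_cst.
Qed.

Lemma CkD (W : normedModType R) k (U : set V) (f g : V -> W) :
  open U -> Ck k U f -> Ck k U g -> Ck k U (f + g).
Proof.
move=> oU; elim: k f g => [|k IH] f g [cf Df] [cg Dg];
  split=> //; try by move=> x Ux; apply: continuousD; [exact: cf|exact: cg].
move=> v; have [df Cf] := Df v; have [dg Cg] := Dg v.
split=> [x Ux|]; first exact: derivableD (df _ Ux) (dg _ Ux).
apply: Ck_ext oU _ (IH _ _ Cf Cg) => x Ux.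
by rewrite deriveD; [ |exact: df|exact: dg].
Qed.

Lemma CkM k (U : set V) (f g : V -> R) :
  open U -> Ck k U f -> Ck k U g -> Ck k U (f * g).
Proof.
move=> oU; elim: k f g => [|k IH] f g Hf Hg; have [cf Df] := Hf;
  have [cg Dg] := Hg; split=> //;
  try by move=> x Ux; apply: continuousM; [exact: cf|exact: cg].
move=> v; have [df Cf] := Df v; have [dg Cg] := Dg v.
split=> [x Ux|]; first exact: derivableM (df _ Ux) (dg _ Ux).
have := CkD oU (IH _ _ (Ck_le Hf) Cg) (IH _ _ (Ck_le Hg) Cf).
apply: Ck_ext oU _ => x Ux.
by rewrite deriveM; [ |exact: df|exact: dg].
Qed.

End SmoothMaps.

Definition locally_finite (T : topologicalType) (F : set (set T)) : Prop :=
  forall x : T, exists2 N, nbhs x N & finite_set [set A | F A /\ A `&` N !=set0].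

Definition open_cover (T : topologicalType) (F : set (set T)) : Prop :=
  F `<=` open /\ \bigcup_(A in F) A = setT.

Definition paracompact (T : topologicalType) : Prop :=
  forall F : set (set T), open_cover F -> exists G : set (set T),
    [/\ open_cover G, locally_finite G &
        forall A, G A -> exists2 B, F B & A `<=` B].

Section Charts.
Variables (R : realType) (n : nat) (T : topologicalType).

Record chart := Chart {
  chart_dom : set T;
  chart_cod : set 'rV[R]_n;
  chart_map : T -> 'rV[R]_n;
  chart_inv : 'rV[R]_n -> T;
  chart_dom_open : open chart_dom;
  chart_cod_open : open chart_cod;
  chart_map_cod : forall p, chart_dom p -> chart_cod (chart_map p);
  chart_inv_dom : forall x, chart_cod x -> chart_dom (chart_inv x);
  chart_mapK : forall p, chart_dom p -> chart_inv (chart_map p) = p;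
  chart_invK : forall x, chart_cod x -> chart_map (chart_inv x) = x;
  chart_map_continuous :
    forall p, chart_dom p -> {for p, continuous chart_map};
  chart_inv_continuous :
    forall x, chart_cod x -> {for x, continuous chart_inv} }.

Definition smooth_transition (c d : chart) : Prop :=
  smooth_on (chart_cod c `&` chart_inv c @^-1` chart_dom d)
            (chart_map d \o chart_inv c).

End Charts.

Record smoothManifold (R : realType) (n : nat) := SmoothManifold {
  manifold_space :> topologicalType;
  atlas : set (chart R n manifold_space);
  manifold_hausdorff : hausdorff_space manifold_space;
  manifold_paracompact : paracompact manifold_space;
  atlas_cover : \bigcup_(c in atlas) chart_dom c = setT;
  atlas_smooth :
    forall c d, atlas c -> atlas d -> smooth_transition c d }.

Arguments atlas {R n} s.

Section SmoothFunctions.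
Variables (R : realType) (n : nat) (M : smoothManifold R n).

Definition smooth_fun (f : M -> R) : Prop :=
  forall c, atlas M c -> smooth_on (chart_cod c) (f \o chart_inv c).

Definition smooth_pred : {pred M -> R} := fun f => `[< smooth_fun f >].

Lemma smooth_predP f : reflect (smooth_fun f) (f \in smooth_pred).
Proof. exact: asboolP. Qed.

Lemma smooth_fun_cst (a : R) : smooth_fun (fun=> a).
Proof. by move=> c _ k; exact: Ck_cst. Qed.

Lemma smooth_funD f g : smooth_fun f -> smooth_fun g -> smooth_fun (f + g).
Proof.
by move=> sf sg c ac k; apply: CkD (sf c ac k) (sg c ac k); exact: chart_cod_open.
Qed.

Lemma smooth_funM f g : smooth_fun f -> smooth_fun g -> smooth_fun (f * g).
Proof.
by move=> sf sg c ac k; apply: CkM (sf c ac k) (sg c ac k); exact: chart_cod_open.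
Qed.

Lemma smooth_funZ a f : smooth_fun f -> smooth_fun (a *: f).
Proof. exact: smooth_funM (smooth_fun_cst a). Qed.

Lemma smooth_funN f : smooth_fun f -> smooth_fun (- f).
Proof. by rewrite -scaleN1r; exact: smooth_funZ. Qed.

Lemma smooth_funB f g : smooth_fun f -> smooth_fun g -> smooth_fun (f - g).
Proof. by move=> sf sg; exact: smooth_funD sf (smooth_funN sg). Qed.

Lemma smooth_subring_closed : subring_closed smooth_pred.
Proof.
split; first by apply/smooth_predP; exact: smooth_fun_cst.
- by move=> f g /smooth_predP sf /smooth_predP sg; apply/smooth_predP/smooth_funB.
- by move=> f g /smooth_predP sf /smooth_predP sg; apply/smooth_predP/smooth_funM.
Qed.

Lemma smooth_submod_closed : submod_closed smooth_pred.
Proof.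
split; first by apply/smooth_predP; exact: smooth_fun_cst.
move=> a f g /smooth_predP sf /smooth_predP sg.
by apply/smooth_predP/smooth_funD => //; exact: smooth_funZ.
Qed.

HB.instance Definition _ :=
  GRing.isSubringClosed.Build (M -> R) smooth_pred smooth_subring_closed.
HB.instance Definition _ :=
  GRing.isSubmodClosed.Build R (M -> R) smooth_pred smooth_submod_closed.

Record Cinf := MkCinf { Cinf_fun :> M -> R; _ : Cinf_fun \in smooth_pred }.

HB.instance Definition _ := [isSub for Cinf_fun].
HB.instance Definition _ := [Choice of Cinf by <:].
HB.instance Definition _ :=
  GRing.SubChoice_isSubComPzRing.Build (M -> R) smooth_pred Cinf
    smooth_subring_closed.
HB.instance Definition _ := [SubZmodule_isSubLmodule of Cinf by <:].

Definition mkCinf (f : M -> R) (sf : smooth_fun f) : Cinf :=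
  MkCinf (introT (smooth_predP f) sf).

Lemma Cinf_smooth (f : Cinf) : smooth_fun f.
Proof. exact/smooth_predP/(valP f). Qed.

End SmoothFunctions.
Arguments smooth_fun {R n M} f.

(* Tangent vectors at p are the derivations of the algebra of smooth functions
   at p. *)
Section Tangent.
Variables (R : realType) (n : nat) (M : smoothManifold R n) (p : M).

Definition derivation_at : {pred Cinf M -> R} := fun v =>
  `[< scalar v /\
      (forall f g, v (f * g) = f p * v g + g p * v f) >].

Lemma derivation_at_submod_closed : submod_closed derivation_at.
Proof.
split.
  by apply/asboolP; split=> [a f g|f g]; rewrite /GRing.zero/= ?mulr0 ?addr0.
move=> a v w /asboolP[vL vM] /asboolP[wL wM]; apply/asboolP.
split=> [b f g|f g]; rewrite !fctE ?(vL, wL, vM, wM); rewrite /GRing.scale/=; ring.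
Qed.

HB.instance Definition _ :=
  GRing.isSubmodClosed.Build R (Cinf M -> R) derivation_at
    derivation_at_submod_closed.

Record tangent := MkTangent {
  tangent_fun :> Cinf M -> R; _ : tangent_fun \in derivation_at }.

HB.instance Definition _ := [isSub for tangent_fun].
HB.instance Definition _ := [Choice of tangent by <:].
HB.instance Definition _ := [SubChoice_isSubLmodule of tangent by <:].

Definition linear_form : {pred tangent -> R} := fun xi =>
  `[< scalar xi >].

Lemma linear_form_submod_closed : submod_closed linear_form.
Proof.
split.
  by apply/asboolP => a u v; rewrite /GRing.zero/= ?mulr0 ?addr0.
move=> a v w /asboolP vL /asboolP wL; apply/asboolP => b f g.
by rewrite !fctE ?(vL, wL); rewrite /GRing.scale/=; ring.
Qed.

HB.instance Definition _ :=
  GRing.isSubmodClosed.Build R (tangent -> R) linear_form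
    linear_form_submod_closed.

Record cotangent := MkCotangent {
  cotangent_fun :> tangent -> R; _ : cotangent_fun \in linear_form }.

HB.instance Definition _ := [isSub for cotangent_fun].
HB.instance Definition _ := [Choice of cotangent by <:].
HB.instance Definition _ := [SubChoice_isSubLmodule of cotangent by <:].

End Tangent.

Section Tensors.
Variables (R : realType) (n : nat) (M : smoothManifold R n).

Definition smooth_section (s : forall p : M, tangent p) : Prop :=
  forall f : Cinf M, smooth_fun (fun p => s p f).

Record vectorField := VectorField {
  field_at :> forall p : M, tangent p;
  field_smooth : smooth_section field_at }.

Record oneForm := OneForm {
  form_at :> forall p : M, cotangent p;
  form_smooth : forall X : vectorField, smooth_fun (fun p => form_at p (X p)) }.

Definition bilinear_form (U : lmodType R) (b : U -> U -> R) : Prop :=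
  (forall v, scalar (b^~ v)) /\ forall u, scalar (b u).

Record tensor2 := Tensor2 {
  tensor_at :> forall p : M, tangent p -> tangent p -> R;
  tensor_bilinear : forall p, bilinear_form (@tensor_at p);
  tensor_smooth : forall X Y : vectorField,
    smooth_fun (fun p => @tensor_at p (X p) (Y p)) }.

Record bivector := Bivector {
  bivector_at :> forall p : M, cotangent p -> cotangent p -> R;
  bivector_bilinear : forall p, bilinear_form (@bivector_at p);
  bivector_alt : forall p (xi : cotangent p), @bivector_at p xi xi = 0;
  bivector_smooth : forall a b : oneForm,
    smooth_fun (fun p => @bivector_at p (a p) (b p)) }.

Arguments tensor_at : clear implicits.
Arguments bivector_at : clear implicits.

Implicit Types (X Y Z E : vectorField) (a b c : oneForm) (P Q : bivector)
  (T B w : tensor2) (f g : Cinf M).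

Lemma vectorField_ext X Y : (forall p, X p = Y p) -> X = Y.
Proof.
case: X Y => [X sX] [Y sY] /= XY.
have eXY : X = Y := functional_extensionality_dep XY.
by subst Y; congr VectorField; exact: Prop_irrelevance.
Qed.

Definition field_app X f : Cinf M := mkCinf (field_smooth X f).
Definition form_app a X : Cinf M := mkCinf (form_smooth a X).
Definition tensor_eval T X Y : Cinf M := mkCinf (tensor_smooth T X Y).
Definition bivector_eval P a b : Cinf M := mkCinf (bivector_smooth P a b).

Section TangentTheory.
Variable p : M.
Implicit Types (u v : tangent p) (xi : cotangent p).

Lemma tangent_linear v : scalar v.
Proof. by have /asboolP[] : tangent_fun v \in derivation_at p := valP v. Qed.

Lemma tangent_leibniz v f g : v (f * g) = f p * v g + g p * v f.
Proof. by have /asboolP[] : tangent_fun v \in derivation_at p := valP v. Qed.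

Lemma cotangent_linear xi : scalar xi.
Proof. by have /asboolP : cotangent_fun xi \in @linear_form _ _ M p := valP xi. Qed.

Lemma tangent_eq u v : (forall f, u f = v f) -> u = v.
Proof. by move=> uv; apply/val_inj/funext. Qed.

Lemma cotangent_eq (xi eta : cotangent p) : (forall v, xi v = eta v) -> xi = eta.
Proof. by move=> uv; apply/val_inj/funext. Qed.

Lemma tangent_valE :
  (forall u v f, (u + v) f = u f + v f) * (forall u f, (- u) f = - u f)
  * (forall (k : R) u f, (k *: u) f = k * u f).
Proof. by []. Qed.

Lemma tangentD v f g : v (f + g) = v f + v g.
Proof. by have := tangent_linear v 1 f g; rewrite scale1r mul1r. Qed.

Lemma tangent0 v : v 0 = 0.
Proof. by apply: (@addrI _ (v 0)); rewrite -tangentD !addr0. Qed.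

Lemma tangentZ v (k : R) f : v (k *: f) = k * v f.
Proof. by have := tangent_linear v k f 0; rewrite !addr0 tangent0 addr0. Qed.

Lemma tangentB v f g : v (f - g) = v f - v g.
Proof. by rewrite -scaleN1r tangentD tangentZ mulN1r. Qed.

Lemma cotangentD xi u v : xi (u + v) = xi u + xi v.
Proof. by have := cotangent_linear xi 1 u v; rewrite scale1r mul1r. Qed.

Lemma cotangent0 xi : xi 0 = 0.
Proof. by apply: (@addrI _ (xi 0)); rewrite -cotangentD !addr0. Qed.

Lemma cotangentZ xi (k : R) v : xi (k *: v) = k * xi v.
Proof. by have := cotangent_linear xi k v 0; rewrite !addr0 cotangent0 addr0. Qed.

Lemma cotangentN xi v : xi (- v) = - xi v.
Proof. by rewrite -scaleN1r cotangentZ mulN1r. Qed.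

Lemma cotangentB xi u v : xi (u - v) = xi u - xi v.
Proof. by rewrite -scaleN1r cotangentD cotangentZ mulN1r. Qed.

End TangentTheory.

Section LieBracket.
Variables X Y : vectorField.

Definition lie_fun (p : M) : Cinf M -> R :=
  fun f => X p (field_app Y f) - Y p (field_app X f).

Lemma lie_derivation p : lie_fun p \in derivation_at p.
Proof.
have dL Z k f g : field_app Z (k *: f + g) = k *: field_app Z f + field_app Z g.
  by apply/val_inj/funext => q; exact: tangent_linear.
have dM Z f g : field_app Z (f * g) = f * field_app Z g + g * field_app Z f.
  by apply/val_inj/funext => q; exact: tangent_leibniz.
apply/asboolP; split=> [k f g|f g]; rewrite /lie_fun.
  by rewrite !dL !tangent_linear; ring.
by rewrite !dM !tangentD !tangent_leibniz /=; ring.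
Qed.

Lemma lie_smooth : smooth_section (fun p => MkTangent (lie_derivation p)).
Proof.
move=> f; apply: smooth_funB.
  exact: field_smooth X (field_app Y f).
exact: field_smooth Y (field_app X f).
Qed.

Definition lie : vectorField := VectorField lie_smooth.
End LieBracket.

Section Differential.
Variable f : Cinf M.

Lemma differential_linear p : (fun v : tangent p => v f) \in @linear_form _ _ M p.
Proof. exact/asboolP. Qed.

Definition differential : oneForm :=
  @OneForm (fun p => MkCotangent (differential_linear p)) (fun X => field_smooth X f).
End Differential.

(* d(alpha) and L_X alpha, evaluated on vector fields; the determinant
   convention is used, so that there is no factor 1/2 in d(alpha). *)
Definition d_form a X Y (p : M) : R :=
  X p (form_app a Y) - Y p (form_app a X) - a p (lie X Y p).

Definition Lie_form X a Y (p : M) : R := X p (form_app a Y) - a p (lie X Y p).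

Definition d_tensor w X Y Z (p : M) : R :=
  X p (tensor_eval w Y Z) - Y p (tensor_eval w X Z) + Z p (tensor_eval w X Y)
  - w p (lie X Y p) (Z p) + w p (lie X Z p) (Y p) - w p (lie Y Z p) (X p).

Definition Lie_tensor X w Y Z (p : M) : R :=
  X p (tensor_eval w Y Z) - w p (lie X Y p) (Z p) - w p (Y p) (lie X Z p).

Definition wedge_form a w X Y Z (p : M) : R :=
  a p (X p) * w p (Y p) (Z p) + a p (Y p) * w p (Z p) (X p)
  + a p (Z p) * w p (X p) (Y p).

Definition wedge_field E P a b c (p : M) : R :=
  a p (E p) * P p (b p) (c p) + b p (E p) * P p (c p) (a p)
  + c p (E p) * P p (a p) (b p).

Lemma d_differential f X Y p : d_form (differential f) X Y p = 0.
Proof.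
have e Z : form_app (differential f) Z = field_app Z f by exact: val_inj.
by rewrite /d_form !e /= /lie_fun subrr.
Qed.

(* The vector field P(alpha, .), as a derivation of functions. *)
Section Sharp.
Variables (P : bivector) (a : oneForm).

Lemma sharp_derivation p : (fun f => P p (a p) (differential f p)) \in derivation_at p.
Proof.
have [_ Pr] := bivector_bilinear P p.
apply/asboolP; split=> [k f g|f g].
  rewrite -Pr; congr (P p _ _); apply: cotangent_eq => v.
  by rewrite /= tangent_linear.
have -> : differential (f * g) p = f p *: differential g p + g p *: differential f p.
  by apply: cotangent_eq => v; rewrite /= tangent_leibniz.
rewrite Pr; congr (_ + _).
have P0 : P p (a p) 0 = 0.
  have := Pr (a p) 1 0 0; rewrite scale1r addr0 mul1r => /esym/(canRL (addrK _)).
  by rewrite subrr.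
by have := Pr (a p) (g p) (differential f p) 0; rewrite P0 !addr0.
Qed.

Definition sharp : vectorField :=
  @VectorField (fun p => MkTangent (sharp_derivation p))
    (fun f => bivector_smooth P a (differential f)).
End Sharp.

(* The Schouten-Nijenhuis bracket in degrees (1,2), (2,1) and (2,2), with
   multivector fields evaluated on 1-forms.  [X, P] is the Lie derivative of P,
   where P(L_X alpha, beta) is written as -(L_X alpha)(P(beta, .)), and
   [P, X] = -[X, P].  On exact forms [P, Q] is the sum over the cyclic
   permutations of P(alpha, d(Q(beta, gamma))) + Q(alpha, d(P(beta, gamma)));
   the terms in d(alpha) make it linear over functions.
   The sign convention is certified below: [schouten22C] is the graded
   antisymmetry, [schouten12_wedge] and [schouten22_wedge] are the rules
     [X, Y /\ Z] = [X, Y] /\ Z + Y /\ [X, Z],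
     [P, X /\ Y] = [P, X] /\ Y - X /\ [P, Y]. *)
Definition schouten12 X P a b (p : M) : R :=
  X p (bivector_eval P a b)
  + Lie_form X a (sharp P b) p - Lie_form X b (sharp P a) p.

Definition schouten21 P X a b (p : M) : R := - schouten12 X P a b p.

Definition schouten22_term P Q a b c (p : M) : R :=
  sharp P a p (bivector_eval Q b c) + sharp Q a p (bivector_eval P b c)
  - d_form a (sharp P b) (sharp Q c) p - d_form a (sharp Q b) (sharp P c) p.

Definition schouten22 P Q a b c (p : M) : R :=
  schouten22_term P Q a b c p + schouten22_term P Q b c a p
  + schouten22_term P Q c a b p.

Section WedgeFields.
Variables X Y : vectorField.
Let W p (xi eta : cotangent p) : R := xi (X p) * eta (Y p) - xi (Y p) * eta (X p).

Lemma wedge_bilinear p : bilinear_form (@W p).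
Proof.
split=> xi k u v; rewrite /W.
  have -> (q : tangent p) : (k *: u + v) q = k * u q + v q by [].
  have -> (q : tangent p) : (k *: u + v) q = k * u q + v q by [].
  ring.
have e (q : tangent p) : (k *: u + v) q = k * u q + v q by [].
by rewrite !e; ring.
Qed.

Lemma wedge_alt p (xi : cotangent p) : W xi xi = 0.
Proof. by rewrite /W mulrC subrr. Qed.

Lemma wedge_smooth a b : smooth_fun (fun p => W (a p) (b p)).
Proof. exact: Cinf_smooth (form_app a X * form_app b Y - form_app a Y * form_app b X). Qed.

Definition wedge_fields : bivector := Bivector wedge_bilinear wedge_alt wedge_smooth.
End WedgeFields.

Lemma schouten22C P Q a b c p : schouten22 P Q a b c p = schouten22 Q P a b c p.
Proof. by rewrite /schouten22 /schouten22_term; ring. Qed.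

Lemma lieC X Y p : lie Y X p = - lie X Y p.
Proof. by apply: tangent_eq => f; rewrite /= /lie_fun opprB. Qed.

Lemma field_app_sharp_wedge Y Z b f :
  field_app (sharp (wedge_fields Y Z) b) f
  = form_app b Y * field_app Z f - form_app b Z * field_app Y f.
Proof. exact/val_inj. Qed.

Lemma sharp_wedge Y Z b p :
  sharp (wedge_fields Y Z) b p = b p (Y p) *: Z p - b p (Z p) *: Y p.
Proof. exact: tangent_eq. Qed.

Lemma lie_sharp_wedge X Y Z b p :
  lie X (sharp (wedge_fields Y Z) b) p =
  (b p (Y p) *: lie X Z p + X p (form_app b Y) *: Z p)
  - (b p (Z p) *: lie X Y p + X p (form_app b Z) *: Y p).
Proof.
apply: tangent_eq => f.
have e : lie X (sharp (wedge_fields Y Z) b) p f =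
  X p (form_app b Y * field_app Z f - form_app b Z * field_app Y f)
  - (b p (Y p) * Z p (field_app X f) - b p (Z p) * Y p (field_app X f)).
  by rewrite -field_app_sharp_wedge.
rewrite e tangentB !tangent_leibniz !tangent_valE /= /lie_fun; ring.
Qed.

Lemma form_app_sharp_wedge a Y Z b :
  form_app a (sharp (wedge_fields Y Z) b) = form_app b Y * form_app a Z - form_app b Z * form_app a Y.
Proof.
apply/val_inj/funext => p.
transitivity (a p (sharp (wedge_fields Y Z) b p)) => //.
by rewrite sharp_wedge cotangentB !cotangentZ.
Qed.

Lemma wedge_eval Y Z a b :
  bivector_eval (wedge_fields Y Z) a b = form_app a Y * form_app b Z - form_app a Z * form_app b Y.
Proof. exact/val_inj. Qed.

Lemma schouten12_wedge X Y Z a b p :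
  schouten12 X (wedge_fields Y Z) a b p =
  wedge_fields (lie X Y) Z p (a p) (b p) + wedge_fields Y (lie X Z) p (a p) (b p).
Proof.
rewrite /schouten12 /Lie_form wedge_eval !lie_sharp_wedge !form_app_sharp_wedge.
rewrite !tangentB !tangent_leibniz !(cotangentB, cotangentD, cotangentZ) /=.
ring.
Qed.

Lemma d_formC a X Y p : d_form a Y X p = - d_form a X Y p.
Proof.
by rewrite /d_form lieC cotangentN; ring.
Qed.

Lemma d_form_sharp_wedge a X Y Z b p :
  d_form a X (sharp (wedge_fields Y Z) b) p =
  b p (Y p) * d_form a X Z p - b p (Z p) * d_form a X Y p.
Proof.
rewrite /d_form form_app_sharp_wedge lie_sharp_wedge sharp_wedge.
rewrite !tangentB !tangent_leibniz !(cotangentB, cotangentD, cotangentZ) ?tangent_valE /=.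
ring.
Qed.

Lemma schouten22_wedge P X Y a b c p :
  schouten22 P (wedge_fields X Y) a b c p =
  (schouten21 P X a b p * c p (Y p) + schouten21 P X b c p * a p (Y p)
   + schouten21 P X c a p * b p (Y p))
  - (a p (X p) * schouten21 P Y b c p + b p (X p) * schouten21 P Y c a p
     + c p (X p) * schouten21 P Y a b p).
Proof.
rewrite /schouten22 /schouten22_term !d_form_sharp_wedge.
rewrite ![d_form _ (sharp (wedge_fields _ _) _) _ _]d_formC !d_form_sharp_wedge !wedge_eval.
rewrite !sharp_wedge !tangentB !tangent_leibniz.
rewrite ?tangent_valE /=.
rewrite /schouten21 /schouten12 /d_form /Lie_form /=.
have e U V (d : oneForm) : d p (lie U V p) = - d p (lie V U p).
  by rewrite lieC cotangentN.
rewrite ?(e (sharp P a)) ?(e (sharp P b)) ?(e (sharp P c)).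
ring.
Qed.

End Tensors.

Section JacobiStructures.
Variables (R : realType) (n : nat) (M : smoothManifold R n).
Implicit Types (X Y Z E : vectorField M) (T B w : tensor2 M) (P : bivector M).

Definition jacobi_structure P E : Prop :=
  (forall a b c p,
     schouten22 P P a b c p = - 2 * wedge_field E P a b c p) /\
  (forall a b p, schouten21 P E a b p = 0).

Lemma hat_linear T p (u : tangent p) : T p u \in @linear_form _ _ M p.
Proof. by apply/asboolP; case: (tensor_bilinear T p). Qed.

Definition hat T p (u : tangent p) : cotangent p :=
  MkCotangent (hat_linear T u).

Section Parts.
Variable B : tensor2 M.

Lemma transpose_bilinear p : bilinear_form (fun u v : tangent p => B p v u).
Proof. by case: (tensor_bilinear B p). Qed.

Definition transpose : tensor2 M :=
  @Tensor2 _ _ M (fun p u v => B p v u) transpose_bilinear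
    (fun X Y => tensor_smooth B Y X).

Lemma skew_bilinear p :
  bilinear_form (fun u v : tangent p => (B p u v - B p v u) / 2).
Proof.
by have [Bl Br] := tensor_bilinear B p; split=> w k u v;
  rewrite /= ?(Bl w) ?(Br w) /=; ring.
Qed.

Lemma skew_smooth X Y :
  smooth_fun (fun p => (B p (X p) (Y p) - B p (Y p) (X p)) / 2).
Proof.
rewrite (_ : (fun p => _) = 2^-1 *: (tensor_eval B X Y - tensor_eval B Y X)).
  exact: Cinf_smooth.
by apply/funext => p; rewrite /= mulrC.
Qed.

Definition skew_part : tensor2 M :=
  @Tensor2 _ _ M (fun p u v => (B p u v - B p v u) / 2) skew_bilinear
    skew_smooth.

Lemma sym_bilinear p :
  bilinear_form (fun u v : tangent p => (B p u v + B p v u) / 2).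
Proof.
by have [Bl Br] := tensor_bilinear B p; split=> w k u v;
  rewrite /= ?(Bl w) ?(Br w) /=; ring.
Qed.

Lemma sym_smooth X Y :
  smooth_fun (fun p => (B p (X p) (Y p) + B p (Y p) (X p)) / 2).
Proof.
rewrite (_ : (fun p => _) = 2^-1 *: (tensor_eval B X Y + tensor_eval B Y X)).
  exact: Cinf_smooth.
by apply/funext => p; rewrite /= mulrC.
Qed.

Definition sym_part : tensor2 M :=
  @Tensor2 _ _ M (fun p u v => (B p u v + B p v u) / 2) sym_bilinear
    sym_smooth.

End Parts.

Definition distribution : Type := forall p : M, set (tangent p).

Definition Ker T : distribution := fun p => [set u | hat T u = 0].

Definition section_of (H : distribution) X : Prop := forall p, H p (X p).

(* Vector subbundle: locally spanned by a pointwise independent family of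
   smooth vector fields; taking these on the whole of M is no restriction, by
   multiplying them by a bump function and shrinking U. *)
Definition subbundle (H : distribution) : Prop :=
  forall p : M, exists U : set M, exists k : nat, exists X : 'I_k -> vectorField M,
    open_nbhs p U /\ forall q, U q ->
      (forall u, H q u <-> exists c : 'I_k -> R, u = \sum_i c i *: X i q) /\
      (forall c : 'I_k -> R, \sum_i c i *: X i q = 0 -> forall i, c i = 0).

Definition direct_sum (H V : distribution) : Prop :=
  forall (p : M),
    (forall u : tangent p, exists h v, [/\ H p h, V p v & u = h + v]) /\
    (forall u : tangent p, H p u -> V p u -> u = 0).

(* Isomorphism of vector bundles: the inverse is smooth too. *)
Definition nondegenerate_tensor T : Prop :=
  exists psi : forall p : M, cotangent p -> tangent p,
    [/\ forall p, cancel (@hat T p) (psi p),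
        forall p, cancel (psi p) (@hat T p) &
        forall a : oneForm M, smooth_section (fun p => psi p (a p))].

(* The inverse of \hat T at p, when it is bijective. *)
Definition hat_inv T p (xi : cotangent p) : tangent p :=
  xget 0 [set u | hat T u = xi].

(* The projection onto H along V, when they are complementary. *)
Definition proj (H V : distribution) p (u : tangent p) : tangent p :=
  xget 0 [set h | H p h /\ V p (u - h)].

(* The vector field with given values, when they vary smoothly. *)
Lemma zero_smooth : smooth_section (fun p : M => 0 : tangent p).
Proof. by move=> f; exact: smooth_fun_cst. Qed.

Definition field_of (s : forall p : M, tangent p) : vectorField M :=
  if pselect (smooth_section s) is left ss then VectorField ss
  else VectorField zero_smooth.

Lemma field_ofE s : smooth_section s -> forall p, field_of s p = s p.
Proof. by rewrite /field_of; case: pselect. Qed.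

Definition proj_field (H V : distribution) X : vectorField M :=
  field_of (fun p => proj H V (X p)).

Definition curv (H V : distribution) X Y : vectorField M :=
  proj_field V H (lie (proj_field H V X) (proj_field H V Y)).

Section MinusInverse.
Variables (B : tensor2 M) (hB : nondegenerate_tensor B).

Lemma hat_inv_eq p (psi : cotangent p -> tangent p) :
  cancel (@hat B p) psi -> cancel psi (@hat B p) -> @hat_inv B p = psi.
Proof.
move=> hK psiK; apply/funext => xi; rewrite /hat_inv.
by case: xgetP => [u _ <-|/(_ (psi xi))]; rewrite /= ?hK// psiK.
Qed.

Lemma hat_invK p : cancel (@hat_inv B p) (@hat B p).
Proof.
by case: hB => psi [hK psiK _] xi; rewrite (hat_inv_eq (hK p) (psiK p)) psiK.
Qed.

Lemma hatK p : cancel (@hat B p) (@hat_inv B p).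
Proof.
by case: hB => psi [hK psiK _] u; rewrite (hat_inv_eq (hK p) (psiK p)) hK.
Qed.

Lemma hat_inv_smooth (a : oneForm M) :
  smooth_section (fun p => hat_inv B (a p)).
Proof.
case: hB => psi [hK psiK spsi] f; have := spsi a f.
congr smooth_fun; apply/funext => p.
by rewrite (hat_inv_eq (hK p) (psiK p)).
Qed.

Lemma hat_inv_linear p k (xi eta : cotangent p) :
  hat_inv B (k *: xi + eta) = k *: hat_inv B xi + hat_inv B eta.
Proof.
apply: (can_inj (@hatK p)); rewrite hat_invK; apply: cotangent_eq => v.
have [Bl _] := tensor_bilinear B p.
by rewrite /= (Bl v) -[in LHS](hat_invK xi) -[in LHS](hat_invK eta).
Qed.

Let L p (xi eta : cotangent p) : R :=
  - skew_part B p (hat_inv B xi) (hat_inv B eta).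

Lemma Lambda_bilinear p : bilinear_form (@L p).
Proof.
have [wl wr] := tensor_bilinear (skew_part B) p.
by split=> eta k xi xi'; rewrite /L hat_inv_linear ?(wl (hat_inv B eta))
  ?(wr (hat_inv B eta)) opprD mulrN.
Qed.

Lemma Lambda_alt p (xi : cotangent p) : L xi xi = 0.
Proof. by rewrite /L /= subrr mul0r oppr0. Qed.

Lemma Lambda_smooth (a b : oneForm M) : smooth_fun (fun p => L (a p) (b p)).
Proof.
exact: smooth_funN (tensor_smooth (skew_part B)
  (VectorField (hat_inv_smooth a)) (VectorField (hat_inv_smooth b))).
Qed.

Definition Lambda : bivector M :=
  Bivector Lambda_bilinear Lambda_alt Lambda_smooth.

End MinusInverse.

(* For a 1-form abar and a vector field Rv, the field (t^B)^-1(alpha), where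
   t^B is the transpose of \hat B and alpha = abar + t^B(Rv). *)
Definition X_alpha B (abar : oneForm M) (Rv : vectorField M) : vectorField M :=
  field_of (fun p => hat_inv (transpose B) (abar p + hat (transpose B) (Rv p))).

(* A 1-form of type (1,0) is identified with a 1-form vanishing on V. *)
Definition type10 (V : distribution) (a : oneForm M) : Prop :=
  forall p u, V p u -> a p u = 0.

Definition jacobi_conditions B (abar : oneForm M) (Rv : vectorField M) : Prop :=
  let w := skew_part B in
  let H := Ker (sym_part B) in
  let V := Ker w in
  let prH := proj_field H V in
  let Xa := X_alpha B abar Rv in
  [/\ type10 V abar /\ section_of V Rv,
      forall X Y Z p, d_tensor w (prH X) (prH Y) (prH Z) p
                      = wedge_form abar w (prH X) (prH Y) (prH Z) p,
      forall X Y p, curv H V (prH X) (prH Y) p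
                    = w p (prH X p) (prH Y p) *: Rv p &
      (forall X Y p, Lie_tensor Xa w (prH X) (prH Y) p = 0) /\
      (forall X, section_of H X -> section_of H (lie Xa X))].

End JacobiStructures.

(* Main.v *)
Require Import Defs.
From HB Require Import structures.
From mathcomp Require Import all_boot all_order all_algebra.
From mathcomp Require Import all_classical all_reals all_analysis.
From mathcomp Require Import ring.
Set Implicit Arguments.
Unset Strict Implicit.
Unset Printing Implicit Defensive.
Import Order.TTheory GRing.Theory Num.Theory numFieldNormedType.Exports.
Local Open Scope classical_set_scope.
Local Open Scope ring_scope.

(** The two Jacobi identities are evaluated on 1-forms and rewritten in terms of
    the de Rham and Lie derivatives of w, the skew part of B.

    Write H = Ker S and V = Ker w, so that B is w on H, S on V, and mixed terms
    vanish.  For a 1-form a put a^# = Lambda(a, .).  This is the H-component of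
    B^-1(a), and a and w(a^#, .) agree on H ([form_hor]).  Hence every section
    of H is some a^#, and a form is determined by a^#, which gives its
    restriction to H, together with its restriction to V.  Let ver[X, Y] be the
    V-component of a Lie bracket.  Substituting a(u) = w(a^#, u) + a(ver u)
    everywhere gives, with X = a^#, Y = b^#, Z = c^#,

      [Lambda, Lambda](a, b, c)
        = 2 (dw(X, Y, Z) + a(ver[Y, Z]) + b(ver[Z, X]) + c(ver[X, Y])),
      [Lambda, E](a, b)
        = - (L_E w)(X, Y) + a(ver[E, Y]) - b(ver[E, X])

    ([schouten22_Lambda], [schouten21_Lambda]).  A vector field E is the same
    datum as a pair (abar, R): R is its V-component and abar = B(., E_H), and
    then a(E) = abar(a^#) + a(R) ([X_alpha_surj], [form_X_alpha]).  So the
    first Jacobi identity says that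

      (dw - abar /\ w)(X, Y, Z) + a(D(Y, Z)) + b(D(Z, X)) + c(D(X, Y)) = 0,

    where D(X, Y) = ver[X, Y] - w(X, Y) R takes its values in V
    ([jacobi_defect]).  For a, b, c of the form w(X, .), which vanish on V, only
    the first term is left, and this is condition (i); replacing a by S(W, .)
    with W arbitrary then isolates D(Y, Z), and D = 0 is condition (ii).  The
    second identity splits in the same way into the two halves of (iii).  The
    subbundle hypotheses enter when D is cancelled: they extend any tangent
    vector to a global vector field W ([direct_sum_extend]). *)

Local Notation distribution := Defs.distribution.
Local Notation proj := Defs.proj.

(** * Tensors, kernels and projections *)

Section TensorAlgebra.
Variables (R : realType) (n : nat) (M : smoothManifold R n).
Implicit Types (T B : tensor2 M) (X : vectorField M) (p : M).

Lemma tangentN p (v : tangent p) f : v (- f) = - v f.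
Proof. by rewrite -scaleN1r tangentZ mulN1r. Qed.

Lemma tensorDl T p (u v x : tangent p) : T p (u + v) x = T p u x + T p v x.
Proof.
by have := (tensor_bilinear T p).1 x 1 u v; rewrite scale1r mul1r.
Qed.

Lemma tensorDr T p (u v x : tangent p) : T p x (u + v) = T p x u + T p x v.
Proof.
by have := (tensor_bilinear T p).2 x 1 u v; rewrite scale1r mul1r.
Qed.

Lemma tensorNr T p (u x : tangent p) : T p x (- u) = - T p x u.
Proof. exact: (cotangentN (hat T x) u). Qed.

Lemma tensorNl T p (u x : tangent p) : T p (- u) x = - T p u x.
Proof. exact: (tensorNr (transpose T)). Qed.

Lemma tensorBl T p (u v x : tangent p) : T p (u - v) x = T p u x - T p v x.
Proof. by rewrite tensorDl tensorNl. Qed.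

Lemma tensorBr T p (u v x : tangent p) : T p x (u - v) = T p x u - T p x v.
Proof. by rewrite tensorDr tensorNr. Qed.

Lemma tensorZl T p k (u x : tangent p) : T p (k *: u) x = k * T p u x.
Proof. exact: (cotangentZ (hat (transpose T) x)). Qed.

Lemma KerP T p (u : tangent p) : Ker T u <-> forall v, T p u v = 0.
Proof.
split=> [Tu v|Tu]; last by apply: cotangent_eq => v; exact: Tu.
by rewrite -[LHS]/(hat T u v) [hat T u]Tu.
Qed.

Lemma KerB T p (u v : tangent p) : Ker T u -> Ker T v -> Ker T (u - v).
Proof.
move=> /KerP Tu /KerP Tv; apply/KerP => x.
by rewrite tensorBl Tu Tv subrr.
Qed.

Lemma skew_add_sym B p (u v : tangent p) :
  B p u v = skew_part B p u v + sym_part B p u v.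
Proof. by rewrite /=; field. Qed.

Lemma skewC B p (u v : tangent p) : skew_part B p u v = - skew_part B p v u.
Proof. by rewrite /=; field. Qed.

Lemma symC B p (u v : tangent p) : sym_part B p u v = sym_part B p v u.
Proof. by rewrite /=; field. Qed.

Definition tensor_form T X : oneForm M :=
  @OneForm _ _ M (fun p => hat T (X p)) (tensor_smooth T X).

(** The local frames of a subbundle are made of global vector fields, so a
    combination with constant coefficients extends a vector without any bump
    function. *)
Lemma subbundle_extend (H : distribution M) p (u : tangent p) :
  subbundle H -> H p u -> exists X : vectorField M, X p = u.
Proof.
move=> /(_ p) [U [k [X [oU HU]]]] /(proj1 (HU p (nbhs_singleton
  (open_nbhs_nbhs oU)))) [c ->].
suff sX : smooth_section (fun q : M => \sum_i c i *: X i q).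
  by exists (VectorField sX).
elim: (index_enum _) => [|i r IH] f.
  rewrite (_ : (fun q => _) = fun=> 0); first exact: smooth_fun_cst.
  by apply/funext => q; rewrite big_nil.
rewrite (_ : (fun q => _) = (c i *: field_app (X i) f : M -> R)
    + (fun q => (\sum_(j <- r) c j *: X j q) f)).
  by apply: smooth_funD (IH f); exact: Cinf_smooth.
by apply/funext => q; rewrite big_cons.
Qed.

Lemma direct_sumC (H V : distribution M) : direct_sum H V -> direct_sum V H.
Proof.
move=> HV p; have [HVe HV0] := HV p; split=> [u|u Vu Hu]; last exact: HV0.
by have [h [v [Hh Vv ->]]] := HVe u; exists v, h; rewrite addrC.
Qed.

Lemma direct_sum_extend (H V : distribution M) p (u : tangent p) :
  subbundle H -> subbundle V -> direct_sum H V ->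
  exists X : vectorField M, X p = u.
Proof.
move=> sH sV /(_ p) [/(_ u) [h [v [Hh Vv ->]]] _].
have [X <-] := subbundle_extend sH Hh; have [Y <-] := subbundle_extend sV Vv.
have sXY : smooth_section (fun q => X q + Y q).
  by move=> f; exact: smooth_funD (field_smooth X f) (field_smooth Y f).
by exists (VectorField sXY).
Qed.

Lemma projP (H V : distribution M) p (u : tangent p) :
  direct_sum H V -> H p (proj H V u) /\ V p (u - proj H V u).
Proof.
move=> /(_ p) [/(_ u) [h [v [Hh Vv uhv]]] _]; rewrite /proj.
case: xgetP => [x _ []//|/(_ h) []]; split=> //.
by rewrite uhv addrC addKr.
Qed.

Lemma proj_unique T1 T2 p (u h : tangent p) :
  direct_sum (Ker T1) (Ker T2) -> Ker T1 h -> Ker T2 (u - h) ->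
  proj (Ker T1) (Ker T2) u = h.
Proof.
move=> HV Hh Vh; have [Hu Vu] := projP u HV; apply/eqP; rewrite -subr_eq0.
apply/eqP/(proj2 (HV p)); first exact: KerB.
suff -> : proj (Ker T1) (Ker T2) u - h = (u - h) - (u - proj (Ker T1) (Ker T2) u)
  by exact: KerB.
by rewrite opprB [RHS]addrC addrA subrK.
Qed.

Lemma proj_id T1 T2 p (u : tangent p) :
  direct_sum (Ker T1) (Ker T2) -> Ker T1 u -> proj (Ker T1) (Ker T2) u = u.
Proof.
move=> HV Hu; apply: proj_unique => //.
by apply/KerP => v; rewrite tensorBl subrr.
Qed.

Lemma proj_compl T1 T2 p (u : tangent p) :
  direct_sum (Ker T1) (Ker T2) ->
  proj (Ker T2) (Ker T1) u = u - proj (Ker T1) (Ker T2) u.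
Proof.
move=> HV; have [Hu Vu] := projP u HV.
by apply: proj_unique; [exact: direct_sumC| |rewrite opprB addrC subrK].
Qed.

End TensorAlgebra.

(** * The splitting defined by B *)

Section SkewSymmetricSplitting.
Variables (R : realType) (n : nat) (M : smoothManifold R n) (B : tensor2 M).
Hypothesis hB : nondegenerate_tensor B.
Let w := skew_part B.
Let s := sym_part B.
Let H := Ker s.
Let V := Ker w.
Hypothesis hHV : direct_sum H V.
Hypotheses (hH : subbundle H) (hV : subbundle V).
Implicit Types (X Y Z E W : vectorField M) (a b c : oneForm M) (p : M).

Let prH p (u : tangent p) : tangent p := proj H V u.

Lemma prH_hor p (u : tangent p) : H (prH u).
Proof. by have [] := projP u hHV. Qed.

Lemma prH_ver p (u : tangent p) : V (u - prH u).
Proof. by have [] := projP u hHV. Qed.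

Lemma horl p (u v : tangent p) : H u -> B p u v = w p u v.
Proof. by move=> /KerP su; rewrite skew_add_sym [X in _ + X]su addr0. Qed.

Lemma horr p (u v : tangent p) : H v -> B p u v = w p u v.
Proof. by move=> /KerP su; rewrite skew_add_sym symC [X in _ + X]su addr0. Qed.

Lemma verr p (u v : tangent p) : V v -> B p u v = s p u v.
Proof.
by move=> /KerP su; rewrite skew_add_sym skewC [X in - X + _]su oppr0 add0r.
Qed.

Lemma verl p (u v : tangent p) : V u -> B p u v = s p u v.
Proof. by move=> /KerP wu; rewrite skew_add_sym [X in X + _]wu add0r. Qed.

Lemma wC p (u v : tangent p) : w p u v = - w p v u.
Proof. exact: skewC. Qed.

Lemma w_prHl p (u v : tangent p) : w p (prH u) v = w p u v.
Proof.
by have /KerP/(_ v) := prH_ver u; rewrite tensorBl => /eqP; rewrite subr_eq0 => /eqP.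
Qed.

Lemma w_prHr p (u v : tangent p) : w p u (prH v) = w p u v.
Proof. by rewrite /w skewC [RHS]skewC; congr (- _); exact: w_prHl. Qed.

(** S is non-degenerate on V, and a vector is detected by the values of S on
    vector fields because these take every value at p. *)
Lemma ver_separate p (u : tangent p) :
  V u -> (forall W, s p (W p) u = 0) -> u = 0.
Proof.
move=> Vu su; apply: (proj2 (hHV p)) => //; apply/KerP => v.
have [W <-] := direct_sum_extend v hH hV hHV.
by rewrite /s symC; exact: su.
Qed.

(** B maps u_H to w(u, .).  This formula makes the projection smooth, since
    the inverse of B is. *)
Lemma prHE p (u : tangent p) : prH u = hat_inv B (hat w u).
Proof.
rewrite -[LHS](hatK hB); congr hat_inv; apply: cotangent_eq => v.
by rewrite [LHS]horl ?w_prHl//; exact: prH_hor.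
Qed.

Lemma prH_smooth X : smooth_section (fun p => prH (X p)).
Proof.
move=> f; have := hat_inv_smooth hB (tensor_form w X) f.
by congr smooth_fun; apply/funext => p; rewrite prHE.
Qed.

Lemma proj_field_horE X p : proj_field H V X p = prH (X p).
Proof. exact: field_ofE (prH_smooth X) p. Qed.

Lemma prV_smooth X : smooth_section (fun p => X p - prH (X p)).
Proof.
by move=> f; exact: (smooth_funB (field_smooth X f) (prH_smooth X f)).
Qed.

Lemma proj_field_verE X p : proj_field V H X p = X p - prH (X p).
Proof.
have e : (fun q => proj V H (X q)) = (fun q => X q - prH (X q)).
  by apply: functional_extensionality_dep => q; exact: proj_compl.
by rewrite /proj_field e (field_ofE (prV_smooth X)).
Qed.

Lemma proj_field_id X : section_of H X -> proj_field H V X = X.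
Proof.
by move=> HX; apply: vectorField_ext => p; rewrite proj_field_horE; exact: proj_id hHV (HX p).
Qed.

Lemma proj_field_hor X : section_of H (proj_field H V X).
Proof. by move=> p; rewrite proj_field_horE; exact: prH_hor. Qed.

Lemma curvE X Y : section_of H X -> section_of H Y -> forall p,
  curv H V X Y p = lie X Y p - prH (lie X Y p).
Proof.
by move=> HX HY p; rewrite /curv !proj_field_id// proj_field_verE.
Qed.

(** Passing from B to its transpose changes the sign of w only, so the two
    differ by the reflection r that is -1 on H and 1 on V. *)
Lemma transpose_nondegenerate : nondegenerate_tensor (transpose B).
Proof.
pose r p (u : tangent p) := (u - prH u) - prH u.
have tr p (u : tangent p) : hat (transpose B) (r p u) = hat B u.
  apply: cotangent_eq => v; rewrite /= /r.
  rewrite tensorBr (verr v (prH_ver u)) (horr v (prH_hor u)) w_prHr.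
  rewrite [RHS]skew_add_sym tensorBr -/s [s p v (prH u)]symC.
  rewrite (proj1 (KerP s (prH u)) (prH_hor u)) subr0 /s symC /w skewC.
  by rewrite opprK addrC.
have rr p (u : tangent p) : r p (r p u) = u.
  have HN : prH (r p u) = - prH u.
    apply: proj_unique => //.
      by apply/KerP => v; rewrite tensorNl (proj1 (KerP _ _) (prH_hor u)) oppr0.
    by rewrite /r opprK subrK; exact: prH_ver.
  by rewrite {1}/r HN opprK /r !subrK.
exists (fun p xi => r p (hat_inv B xi)); split=> [p u|p xi|a f].
- by rewrite -{1}[u]rr tr hatK// rr.
- by rewrite tr hat_invK.
- pose U := VectorField (hat_inv_smooth hB a).
  exact: (smooth_funB (prV_smooth U f) (prH_smooth U f)).
Qed.

Let htB := transpose_nondegenerate.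

(** * The Schouten brackets of Lambda *)

Lemma Lambda_prH p (xi eta : cotangent p) :
  Lambda hB p xi eta = eta (prH (hat_inv B xi)).
Proof.
rewrite -[in RHS](hat_invK hB eta) [RHS]horr; last exact: prH_hor.
by rewrite w_prHr /w skewC.
Qed.

Lemma sharp_Lambda a p : sharp (Lambda hB) a p = prH (hat_inv B (a p)).
Proof. by apply: tangent_eq => f; exact: Lambda_prH. Qed.

Notation "a ^#" := (sharp (Lambda hB) a) (at level 2, format "a ^#").

Lemma sharp_hor a : section_of H a^#.
Proof. by move=> p; rewrite sharp_Lambda; exact: prH_hor. Qed.

Lemma form_hor a p (u : tangent p) : H u -> a p u = w p (a^# p) u.
Proof.
by move=> Hu; rewrite -[in LHS](hat_invK hB (a p)) [LHS]horr// sharp_Lambda w_prHl.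
Qed.

(** The two parts in which all brackets below are computed: the H-part of a
    form is carried by its sharp, and its V-part is left untouched. *)
Lemma form_split a p (u : tangent p) : a p u = w p (a^# p) u + a p (u - prH u).
Proof.
by rewrite cotangentB (form_hor a (prH_hor u)) w_prHr addrC subrK.
Qed.

Lemma sharp_skew X : section_of H X -> (tensor_form w X)^# = X.
Proof.
move=> HX; apply: vectorField_ext => p.
have e : prH (X p) = X p := proj_id hHV (HX p).
by rewrite sharp_Lambda -prHE !e.
Qed.

Lemma tensor_form_ver X p (u : tangent p) : V u -> tensor_form w X p u = 0.
Proof. by move=> /KerP Vu; rewrite /= -/(w p _ _) [LHS]skewC Vu oppr0. Qed.

Lemma Lambda_at a b p : Lambda hB p (a p) (b p) = - w p (a^# p) (b^# p).
Proof.
rewrite Lambda_prH -sharp_Lambda (form_hor b (sharp_hor a p)); exact: skewC.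
Qed.

Lemma Lambda_evalE a b :
  bivector_eval (Lambda hB) a b = - tensor_eval w a^# b^#.
Proof. by apply/val_inj/funext => p; exact: Lambda_at. Qed.

Lemma form_app_sharpE a b : form_app a b^# = tensor_eval w a^# b^#.
Proof. by apply/val_inj/funext => p; exact: form_hor (sharp_hor b p). Qed.

Lemma tensor_eval_skewC X Y : tensor_eval w X Y = - tensor_eval w Y X.
Proof. by apply/val_inj/funext => p; exact: skewC. Qed.

Let ver X Y p : tangent p := lie X Y p - prH (lie X Y p).

(** Apart from the factor 2, the cyclic sum of the derivatives X(w(Y, Z)) comes
    three times, with signs -, + and +, so that one copy is left; together
    with the terms w(X, [Y, Z]) it is dw. *)
Lemma schouten22_Lambda a b c p :
  schouten22 (Lambda hB) (Lambda hB) a b c p =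
  2 * (d_tensor w a^# b^# c^# p
    + a p (ver b^# c^# p) + b p (ver c^# a^# p) + c p (ver a^# b^# p)).
Proof.
rewrite /schouten22 /schouten22_term /d_form /d_tensor.
rewrite !Lambda_evalE !form_app_sharpE.
rewrite (form_split a (lie b^# c^# p)) (form_split b (lie c^# a^# p))
  (form_split c (lie a^# b^# p)).
rewrite (tensor_eval_skewC c^# a^#) (tensor_eval_skewC b^# a^#)
  (tensor_eval_skewC c^# b^#).
rewrite !tangentN (lieC c^# a^#) tensorNl.
rewrite -/(ver b^# c^# p) -/(ver c^# a^# p) -/(ver a^# b^# p).
rewrite (wC (lie a^# b^# p)) (wC (lie c^# a^# p)) (wC (lie b^# c^# p)).
ring.
Qed.

Lemma schouten21_Lambda E a b p :
  schouten21 (Lambda hB) E a b p =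
  - Lie_tensor E w a^# b^# p + a p (ver E b^# p) - b p (ver E a^# p).
Proof.
rewrite /schouten21 /schouten12 /Lie_form /Lie_tensor.
rewrite Lambda_evalE !form_app_sharpE.
rewrite (form_split a (lie E b^# p)) (form_split b (lie E a^# p)).
rewrite (tensor_eval_skewC b^# a^#) !tangentN (wC (lie E a^# p)).
rewrite -/(ver E a^# p) -/(ver E b^# p).
ring.
Qed.

(** * Vector fields as pairs of a form of type (1,0) and a section of V *)

Lemma X_alphaE abar Rv p :
  hat (transpose B) (X_alpha B abar Rv p) = abar p + hat (transpose B) (Rv p).
Proof.
have sa X : smooth_fun (fun q => (abar q + hat (transpose B) (Rv q)) (X q)).
  exact: (smooth_funD (form_smooth abar X) (tensor_smooth B X Rv)).
rewrite /X_alpha field_ofE ?hat_invK//.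
exact: hat_inv_smooth htB (OneForm sa).
Qed.

Lemma X_alpha_split abar Rv p :
  X_alpha B abar Rv p = hat_inv (transpose B) (abar p) + Rv p.
Proof.
apply: (can_inj (hatK htB (p:=p))); rewrite X_alphaE.
apply: cotangent_eq => v.
by rewrite [RHS](tensorDr B) -[in LHS](hat_invK htB (abar p)).
Qed.

Section Correspondence.
Variables (abar : oneForm M) (Rv : vectorField M).
Hypotheses (h10 : type10 V abar) (hR : section_of V Rv).
Let E := X_alpha B abar Rv.

(** The defining equation of X_alpha, with R moved to the left: E - R, which is
    the H-part of E, corresponds to abar under the transpose of B. *)
Lemma X_alpha_eval p (v : tangent p) : B p v (E p - Rv p) = abar p v.
Proof.
rewrite tensorBr -[B p v (E p)]/(hat (transpose B) (E p) v) X_alphaE.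
exact: addrK.
Qed.

(** S sees only the V-part of its argument v, on which S(v, .) = B(v, .) and
    abar vanishes. *)
Lemma X_alpha_hor p : H (E p - Rv p).
Proof.
apply/KerP => v; rewrite -[v](subrK (prH v)) tensorDr /s [X in _ + X]symC.
rewrite (proj1 (KerP _ _) (prH_hor v)) addr0 symC -/s.
rewrite -verl; last exact: prH_ver.
by rewrite X_alpha_eval h10//; exact: prH_ver.
Qed.

Lemma form_X_alpha a p : a p (E p) = abar p (a^# p) + a p (Rv p).
Proof.
rewrite -{1}[E p](subrK (Rv p)) cotangentD; congr (_ + _).
rewrite (form_hor a (X_alpha_hor p)) -X_alpha_eval horr//; exact: X_alpha_hor.
Qed.

(** The failure of condition (ii). *)
Let defect X Y p : tangent p := ver X Y p - w p (X p) (Y p) *: Rv p.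

Lemma defect_ver X Y p : V (defect X Y p).
Proof.
apply: KerB; first exact: prH_ver.
by apply/KerP => v; rewrite (tensorZl w) (proj1 (KerP _ _) (hR p)) mulr0.
Qed.

Lemma jacobi_defect a b c p :
  schouten22 (Lambda hB) (Lambda hB) a b c p
    - - 2 * wedge_field E (Lambda hB) a b c p =
  2 * (d_tensor w a^# b^# c^# p - wedge_form abar w a^# b^# c^# p
    + (a p (defect b^# c^# p) + b p (defect c^# a^# p) + c p (defect a^# b^# p))).
Proof.
rewrite schouten22_Lambda /wedge_field /wedge_form !form_X_alpha !Lambda_at.
rewrite /defect !cotangentB !cotangentZ.
ring.
Qed.

(** * The two Jacobi identities and the geometric conditions *)

Lemma jacobi22P :
  (forall a b c p, schouten22 (Lambda hB) (Lambda hB) a b c p =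
     - 2 * wedge_field E (Lambda hB) a b c p) <->
  (forall X Y Z, section_of H X -> section_of H Y -> section_of H Z ->
     forall p, d_tensor w X Y Z p = wedge_form abar w X Y Z p) /\
  (forall X Y, section_of H X -> section_of H Y ->
     forall p, curv H V X Y p = w p (X p) (Y p) *: Rv p).
Proof.
split=> [J|[hi hii] a b c p]; last first.
  have D0 X Y : section_of H X -> section_of H Y -> defect X Y p = 0.
    by move=> HX HY; rewrite /defect -hii// curvE// subrr.
  apply/eqP; rewrite -subr_eq0 jacobi_defect hi ?D0; try exact: sharp_hor.
  by rewrite !cotangent0 subrr !addr0 mulr0.
have J0 a b c p : d_tensor w a^# b^# c^# p - wedge_form abar w a^# b^# c^# p
    + (a p (defect b^# c^# p) + b p (defect c^# a^# p) + c p (defect a^# b^# p)) = 0.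
  have := jacobi_defect a b c p; rewrite J subrr => /esym/eqP.
  by rewrite mulf_eq0 pnatr_eq0/= => /eqP.
have hi X Y Z : section_of H X -> section_of H Y -> section_of H Z ->
     forall p, d_tensor w X Y Z p = wedge_form abar w X Y Z p.
  move=> HX HY HZ p.
  have := J0 (tensor_form w X) (tensor_form w Y) (tensor_form w Z) p.
  rewrite !tensor_form_ver; try exact: defect_ver.
  by rewrite !addr0 !sharp_skew// => /eqP; rewrite subr_eq0 => /eqP.
split=> // X Y HX HY p.
rewrite curvE//; apply/eqP; rewrite -subr_eq0; apply/eqP.
apply: ver_separate (defect_ver X Y p) _ => W.
(* Condition (i) removes the form terms; the forms w(X, .) and w(Y, .) kill V,
   so that only S(W, D(X, Y)) is left. *)
have := J0 (tensor_form s W) (tensor_form w X) (tensor_form w Y) p.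
rewrite hi; try exact: sharp_hor.
rewrite subrr add0r !sharp_skew// [tensor_form w X p _]tensor_form_ver;
  last exact: defect_ver.
by rewrite [tensor_form w Y p _]tensor_form_ver ?addr0//; exact: defect_ver.
Qed.

End Correspondence.

(** Here E is arbitrary; the argument is the one for the first identity, the
    two terms in ver[E, .] being separated by taking b to vanish on V. *)
Lemma jacobi21P E :
  (forall a b p, schouten21 (Lambda hB) E a b p = 0) <->
  (forall X Y, section_of H X -> section_of H Y ->
     forall p, Lie_tensor E w X Y p = 0) /\
  (forall X, section_of H X -> section_of H (lie E X)).
Proof.
have ver0 X p : H (lie E X p) <-> ver E X p = 0.
  rewrite /ver; split=> [HX|/eqP]; first by rewrite /prH proj_id// subrr.
  by rewrite subr_eq0 => /eqP ->; exact: prH_hor.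
split=> [J|[hL hE] a b p]; last first.
  have D0 X : section_of H X -> ver E X p = 0 by move=> HX; exact/ver0/hE.
  rewrite schouten21_Lambda hL ?D0 ?cotangent0; try exact: sharp_hor.
  by rewrite subr0 addr0 oppr0.
have hL X Y : section_of H X -> section_of H Y ->
     forall p, Lie_tensor E w X Y p = 0.
  move=> HX HY p; have := J (tensor_form w X) (tensor_form w Y) p.
  rewrite schouten21_Lambda !tensor_form_ver; try exact: prH_ver.
  by rewrite !sharp_skew// subr0 addr0 => /eqP; rewrite oppr_eq0 => /eqP.
split=> // X HX p; apply/ver0.
apply: ver_separate (prH_ver _) _ => W.
have := J (tensor_form s W) (tensor_form w X) p.
rewrite schouten21_Lambda hL; try exact: sharp_hor.
rewrite sharp_skew// [tensor_form w X p _]tensor_form_ver; last exact: prH_ver.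
by rewrite oppr0 add0r addr0.
Qed.

(** Conditions (i)-(iii) quantify over the projections of all vector fields,
    and these are exactly the sections of H. *)
Lemma jacobi_conditionsP abar Rv :
  jacobi_conditions B abar Rv <->
  [/\ type10 V abar, section_of V Rv &
      jacobi_structure (Lambda hB) (X_alpha B abar Rv)].
Proof.
split.
  move=> [[h10 hR] hi hii [hL hE]]; split=> //; split.
    apply/jacobi22P => //; split=> [X Y Z HX HY HZ p|X Y HX HY p].
      by have := hi X Y Z p; rewrite !proj_field_id.
    by have := hii X Y p; rewrite !proj_field_id.
  apply/jacobi21P; split=> // X Y HX HY p.
  by have := hL X Y p; rewrite !proj_field_id.
move=> [h10 hR [/(jacobi22P h10 hR)[hi hii] /jacobi21P[hL hE]]].
split=> //; [move=> *; apply: hi|move=> *; apply: hii|split=> // *; apply: hL];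
  exact: proj_field_hor.
Qed.

(** The witnesses come from the H-part and the V-part of E. *)
Lemma X_alpha_surj E : exists abar Rv,
  [/\ type10 V abar, section_of V Rv & E = X_alpha B abar Rv].
Proof.
have VR p : V (proj_field V H E p) by rewrite proj_field_verE; exact: prH_ver.
exists (tensor_form (transpose B) (proj_field H V E)), (proj_field V H E).
split=> //.
  move=> p u Vu; rewrite /= horr; last exact: proj_field_hor.
  by move/KerP: Vu => ->.
apply: vectorField_ext => p; rewrite X_alpha_split hatK//.
by rewrite proj_field_horE proj_field_verE addrC subrK.
Qed.

End SkewSymmetricSplitting.

Theorem theorem4p8 (R : realType) (n : nat) (M : smoothManifold R n)
    (B : tensor2 M) (hB : nondegenerate_tensor B)
    (hH : subbundle (Ker (sym_part B)))
    (hV : subbundle (Ker (skew_part B)))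
    (hHV : direct_sum (Ker (sym_part B)) (Ker (skew_part B))) :
  ((exists E : vectorField M, jacobi_structure (Lambda hB) E) <->
   (exists (abar : oneForm M) (Rv : vectorField M),
      jacobi_conditions B abar Rv)) /\
  (forall (abar : oneForm M) (Rv : vectorField M),
     jacobi_conditions B abar Rv ->
     jacobi_structure (Lambda hB) (X_alpha B abar Rv) /\
     forall p : M,
       X_alpha B abar Rv p = hat_inv (transpose B) (abar p) + Rv p) /\
  (forall E : vectorField M, jacobi_structure (Lambda hB) E ->
     exists (abar : oneForm M) (Rv : vectorField M),
       jacobi_conditions B abar Rv /\ E = X_alpha B abar Rv).
Proof.
have condP := jacobi_conditionsP hB hHV hH hV.
have surj E : jacobi_structure (Lambda hB) E ->
    exists abar Rv, jacobi_conditions B abar Rv /\ E = X_alpha B abar Rv.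
  have [abar [Rv [h10 hR ->]]] := X_alpha_surj hB hHV E => J.
  by exists abar, Rv; split=> //; apply/condP.
split; last split=> // abar Rv /condP[_ _ J].
- split=> [[E /surj[abar [Rv []]]]|[abar [Rv /condP[_ _ J]]]]; first by exists abar, Rv.
  by exists (X_alpha B abar Rv).
- by split=> // p; exact: X_alpha_split.
Qed.
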